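(* Let $a<b$ be real, let $n\ge 1$, and let $U_n\subset C^n[a,b]$ be an extended Chebyshev space of dimension $n+1$ over $[a,b]$ containing functions $f_0$ and $f_1$ with $f_0>0$ on $[a,b]$ and $f_1/f_0$ strictly increasing on $[a,b]$. Suppose there exists a generalized Bernstein operator $\mathcal{B}_n:C[a,b]\to U_n$ fixing $f_0$ and $f_1$, written as $$\mathcal{B}_n(f)=\sum_{k=0}^n f(t_{n,k})\,p_{n,k},$$ with nodes $t_{n,k}\in[a,b]$, $t_{n,0}=a$, $t_{n,n}=b$, and with $(p_{n,k})_{k=0}^n$ a non-negative Bernstein basis of $U_n$ (positive weights being absorbed in the $p_{n,k}$). Let $L_n:C[a,b]\to U_n$ be an operator with $L_nf_0=f_0$ and $L_nf_1=f_1$ of the form $$L_n(f)=\sum_{k=0}^n\lambda_{n,k}(f)\,p_{n,k},\qquad \lambda_{n,k}(f):=f_0(t_{n,k})\int_a^b f\,d\mu_{n,k},$$ with the same functions $p_{n,k}$ and nodes $t_{n,k}$ as in $\mathcal{B}_n$, where each $\mu_{n,k}$ ($k=0,\dots,n$) is a positive measure on $[a,b]$. Then for every $(f_0,f_1)$-convex function $\phi\in C[a,b]$ we have $\phi\le\mathcal{B}_n\phi\le L_n\phi$ on $[a,b]$. Moreover, if for some $t\in(a,b)$ and some strictly $(f_0,f_1)$-convex function $\psi\in C[a,b]$ we have $\mathcal{B}_n\psi(t)=L_n\psi(t)$, then $\mathcal{B}_n=L_n$ (that is, $\mathcal{B}_nf=L_nf$ for all $f\in C[a,b]$).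
   Context: All functions are real-valued; measures are Borel measures. Extended Chebyshev space: an extended Chebyshev space $U_n$ of dimension $n+1$ over $[a,b]$ is an $(n+1)$-dimensional linear subspace of $C^n([a,b])$ such that each $f\in U_n$ not vanishing identically has at most $n$ zeros in $[a,b]$, counting multiplicities. Non-negative Bernstein basis: a collection of non-negative functions $p_{n,k}\in U_n$, $k=0,\dots,n$, such that each $p_{n,k}$ has a zero of order (exactly) $k$ at $a$ and a zero of order (exactly) $n-k$ at $b$. (Such a collection is a basis of $U_n$.) Generalized Bernstein operator fixing $f_0,f_1$ (where $f_0,f_1\in U_n$, $f_0>0$, $f_1/f_0$ strictly increasing): an operator $\mathcal{B}_n:C[a,b]\to U_n$ of the form $\mathcal{B}_n(f)=\sum_{k=0}^n f(t_{n,k})\alpha_{n,k}p_{n,k}$ with nodes $t_{n,k}\in[a,b]$, $t_{n,0}=a$, $t_{n,n}=b$, weights $\alpha_{n,k}>0$, and $(p_{n,k})$ a non-negative Bernstein basis of $U_n$, such that $\mathcal{B}_nf_0=f_0$ and $\mathcal{B}_nf_1=f_1$. The weights may be absorbed by replacing $p_{n,k}$ with $\alpha_{n,k}p_{n,k}$. $(f_0,f_1)$-convexity: $\phi$ is $(f_0,f_1)$-convex on $[a,b]$ if for all $x<y$ in $[a,b]$, the unique $h\in\operatorname{Span}\{f_0,f_1\}$ with $h(x)=\phi(x)$ and $h(y)=\phi(y)$ satisfies $\phi\le h$ on $[x,y]$. It is strictly $(f_0,f_1)$-convex if for all such $x<y$ one has $\phi<h$ on $(x,y)$. *)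

(* Defs.v *)
From HB Require Import structures.
From mathcomp Require Import all_boot all_order all_algebra.
From mathcomp Require Import all_classical all_reals all_analysis.
Set Implicit Arguments.
Unset Strict Implicit.
Unset Printing Implicit Defensive.
Import Order.TTheory GRing.Theory Num.Theory.
Import numFieldNormedType.Exports.
Local Open Scope classical_set_scope.
Local Open Scope ring_scope.

(* A function on [a, b] is represented by a total function R -> R whose
   values outside [a, b] are irrelevant. *)

Definition derive_on (R : realType) (a b : R) (f : R -> R) (x : R) : R :=
  lim ((f y - f x) / (y - x) @[y --> within `[a, b] (x^')]).

Definition derivable_on (R : realType) (a b : R) (f : R -> R) : Prop :=
  {in `[a, b], forall x,
    cvg ((f y - f x) / (y - x) @[y --> within `[a, b] (x^')])}.

Definition derive_onn (R : realType) (a b : R) (i : nat) (f : R -> R) :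
  R -> R := iter i (derive_on a b) f.

Definition Cn (R : realType) (a b : R) (n : nat) (f : R -> R) : Prop :=
  (forall i, (i < n)%N -> derivable_on a b (derive_onn a b i f)) /\
  {within `[a, b], continuous (derive_onn a b n f)}.

(* Order of the zero of f at x (0 if f x != 0), for f of class C^n: the first
   i <= n such that the i-th derivative does not vanish at x, and n.+1 if
   there is no such i. *)
Definition zero_order (R : realType) (a b : R) (n : nat) (f : R -> R)
    (x : R) : nat :=
  find (fun i => derive_onn a b i f x != 0) (iota 0 n.+1).

(* U is a linear space of functions on [a, b] of dimension m; as a set of
   functions on R, it is closed under equality on [a, b]. *)
Definition subspace_dim (R : realType) (a b : R) (m : nat)
    (U : set (R -> R)) : Prop :=
  exists e : 'I_m -> R -> R,
    (forall c : 'I_m -> R,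
       {in `[a, b], forall x, \sum_(i < m) c i * e i x = 0} ->
       forall i, c i = 0) /\
    (forall f : R -> R, U f <->
       exists c : 'I_m -> R,
         {in `[a, b], forall x, f x = \sum_(i < m) c i * e i x}).

Definition extended_chebyshev (R : realType) (a b : R) (n : nat)
    (U : set (R -> R)) : Prop :=
  [/\ subspace_dim a b n.+1 U,
      (forall f, U f -> Cn a b n f) &
      (forall f, U f -> (exists2 x, x \in `[a, b] & f x != 0) ->
         forall s : seq R, uniq s -> {subset s <= `[a, b]} ->
           (\sum_(x <- s) zero_order a b n f x <= n)%N)].

Definition bernstein_basis (R : realType) (a b : R) (n : nat)
    (U : set (R -> R)) (p : 'I_n.+1 -> R -> R) : Prop :=
  forall k : 'I_n.+1,
    [/\ U (p k),
        {in `[a, b], forall x, 0 <= p k x},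
        zero_order a b n (p k) a = k &
        zero_order a b n (p k) b = (n - k)%N].

Definition bernstein_op (R : realType) (n : nat) (t : 'I_n.+1 -> R)
    (p : 'I_n.+1 -> R -> R) (f : R -> R) (x : R) : R :=
  \sum_(k < n.+1) f (t k) * p k x.

(* A Borel measure on [a, b] is represented by a Borel measure on R, of which
   only the restriction to [a, b] matters. *)
Definition integral_op (R : realType) (a b : R) (n : nat) (f0 : R -> R)
    (t : 'I_n.+1 -> R) (p : 'I_n.+1 -> R -> R)
    (mu : 'I_n.+1 -> {measure set (measurableTypeR R) -> \bar R})
    (f : R -> R) (x : R) : R :=
  \sum_(k < n.+1) (f0 (t k) * \int[mu k]_(y in `[a, b]) f y) * p k x.

(* When f0 > 0 and f1 / f0 is strictly increasing on [a, b], the coefficients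
   c0 and c1 below exist and are unique. *)
Definition convex2 (R : realType) (a b : R) (f0 f1 phi : R -> R) : Prop :=
  forall x y : R, x \in `[a, b] -> y \in `[a, b] -> x < y ->
  forall c0 c1 : R,
    c0 * f0 x + c1 * f1 x = phi x ->
    c0 * f0 y + c1 * f1 y = phi y ->
    {in `[x, y], forall z, phi z <= c0 * f0 z + c1 * f1 z}.

Definition strict_convex2 (R : realType) (a b : R) (f0 f1 phi : R -> R) :
    Prop :=
  forall x y : R, x \in `[a, b] -> y \in `[a, b] -> x < y ->
  forall c0 c1 : R,
    c0 * f0 x + c1 * f1 x = phi x ->
    c0 * f0 y + c1 * f1 y = phi y ->
    {in `]x, y[, forall z, phi z < c0 * f0 z + c1 * f1 z}.

(* Main.v *)
(* The orders of vanishing at [a] make the [p k] linearly independent, so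
   comparing the coefficients of [B f = L f] for [f = f0, f1] shows that
   [f0 (mu k)] is a probability measure under which [f1 / f0] has mean
   [(f1 / f0) (t k)].  At an interior point a convex [phi] has a support function
   in the span of [f0] and [f1], which both operators fix: evaluating it by [B]
   gives [phi <= B phi], and integrating it gives, coefficient by coefficient,
   the Jensen inequality [B phi <= L phi].  In the strict case the [p k] are
   positive inside [a, b], so equality at one point forces equality in each
   Jensen inequality, whence [mu k] is concentrated at [t k]. *)
Require Import Defs.
From HB Require Import structures.
From mathcomp Require Import all_boot all_order all_algebra.
From mathcomp Require Import all_classical all_reals all_analysis.
From mathcomp Require Import ring lra.
Import Order.TTheory GRing.Theory Num.Theory.
Import numFieldNormedType.Exports.
Local Open Scope classical_set_scope.
Local Open Scope ring_scope.

(** * Linearity of iterated derivatives on [a, b] *)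

Section DeriveOn.
Context {R : realType} {a b : R}.
Hypothesis ab : a < b.

(** This makes the limit in [derive_on] unique. As [a < b], each point of [a, b] is approached by
    other points of it, from the right unless it is [b]. *)
Lemma within_dnbhs_proper (x : R) : x \in `[a, b] ->
  ProperFilter (within `[a, b] (x^')).
Proof.
move=> xab; apply: Build_ProperFilter_ex => A.
rewrite /within/= => /nbhs_ballP [e /= e0] h.
move: xab; rewrite in_itv/= => /andP[ax xb].
have [xltb|] := ltP x b.
  pose y := Num.min b (x + e / 2).
  have xy : x < y by rewrite lt_min xltb ltrDl divr_gt0.
  have yb : y <= b by rewrite ge_min lexx.
  have ye : y <= x + e / 2 by rewrite ge_min lexx orbT.
  exists y; apply: (h y).
  - rewrite /ball/= ltr0_norm; last by rewrite subr_lt0.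
    lra.
  - by rewrite gt_eqF.
  - by rewrite /= in_itv/= yb andbT; lra.
move=> bx.
pose y := Num.max a (x - e / 2).
have xy : y < x by rewrite gt_max (lt_le_trans ab bx) ltrBlDr ltrDl divr_gt0.
have ya : a <= y by rewrite le_max lexx.
have ye : x - e / 2 <= y by rewrite le_max lexx orbT.
exists y; apply: (h y).
- rewrite /ball/= gtr0_norm; last by rewrite subr_gt0.
  lra.
- by rewrite lt_eqF.
- by rewrite /= in_itv/= ya; lra.
Qed.

Lemma derive_on_sum (I : finType) (c : I -> R) (F : I -> R -> R) (G : R -> R) :
  (forall i, derivable_on a b (F i)) ->
  {in `[a, b], forall x, G x = \sum_i c i * F i x} ->
  {in `[a, b], forall x, derive_on a b G x = \sum_i c i * derive_on a b (F i) x}.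
Proof.
move=> dF GF x xab.
have PF := within_dnbhs_proper _ xab.
apply: (cvg_lim (@norm_hausdorff _ _)) => /=.
have -> : \sum_i c i * derive_on a b (F i) x =
  \sum_(i <- index_enum I) c i * derive_on a b (F i) x by [].
have : (\sum_(i <- index_enum I) c i * ((F i y - F i x) / (y - x)))
    @[y --> within `[a, b] (x^')] -->
    \sum_(i <- index_enum I) c i * derive_on a b (F i) x.
  apply: (@cvg_big _ _ _ _ _ _ _ _ _ _) => //.
  - by apply: add_continuous.
  - move=> i _; apply: cvgMl_tmp; exact: (dF i x xab).
(* The two difference quotients agree only on [a, b], which is enough for the restricted filter. *)
apply: cvg_trans; apply: near_eq_cvg.
apply: (@filterE _ (x^')) => y yab /=.
rewrite !GF// -sumrB mulr_suml; apply: eq_bigr => i _.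
by rewrite -mulrBr mulrA.
Qed.

Lemma derive_onn_sum (n : nat) (I : finType) (c : I -> R) (F : I -> R -> R)
    (G : R -> R) (i : nat) :
  (forall j, Cn a b n (F j)) ->
  {in `[a, b], forall x, G x = \sum_j c j * F j x} -> (i <= n)%N ->
  {in `[a, b], forall x,
    derive_onn a b i G x = \sum_j c j * derive_onn a b i (F j) x}.
Proof.
move=> CF GF; elim: i => [//|i IH] lein x xab.
rewrite /derive_onn !iterS; apply: (derive_on_sum _ c _ _ _ _ x xab) => [j|].
  by have [/(_ i lein)] := CF j.
exact: IH (ltnW lein).
Qed.

Lemma derive_onn_eq0 (n : nat) (I : finType) (c : I -> R) (F : I -> R -> R)
    (i : nat) :
  (forall j, Cn a b n (F j)) ->
  {in `[a, b], forall x, \sum_j c j * F j x = 0} -> (i <= n)%N ->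
  {in `[a, b], forall x, \sum_j c j * derive_onn a b i (F j) x = 0}.
Proof.
move=> CF F0 lein x xab.
(* The zero function is expanded twice: with coefficients [c], then with zero coefficients, which
   shows that its derivatives vanish. *)
rewrite -(@derive_onn_sum n _ c F (fun=> 0))// => [|y yab]; last by rewrite F0.
rewrite (@derive_onn_sum n _ (fun=> 0) F)// => [|y yab];
  by rewrite big1 // => ? _; rewrite mul0r.
Qed.

(** Off [x], [f y = f x + q y * (y - x)], where the quotient [q] converges and [y - x] tends to
    0. *)
Lemma derivable_on_continuous (f : R -> R) :
  derivable_on a b f -> {within `[a, b], continuous f}.
Proof.
move=> df; rewrite continuous_subspace_in => x; rewrite inE => xab.
have qf := df x xab.
set q := (fun y => (f y - f x) / (y - x)) in qf.
have qd : f x + q y * (y - x) @[y --> within `[a, b] (x^')] -->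
    f x + lim (q y @[y --> within `[a, b] (x^')]) * (x - x).
  apply: cvgD; first exact: cvg_cst.
  apply: cvgM; first exact: qf.
  apply: cvgB; last exact: cvg_cst.
  by move=> A xA; apply: filterS (nbhs_dnbhs xA) => y Ay _.
rewrite subrr mulr0 addr0 in qd.
apply/cvgrPdist_lt => e e0.
have {}qd : nbhs x (fun y => y != x -> y \in `[a, b] ->
    `|f x - (f x + q y * (y - x))| < e).
  by move/cvgrPdist_lt : qd; exact.
suff : within `[a, b] (nbhs x) (fun y => `|f x - f y| < e).
  by rewrite nbhs_subspace_in.
apply: filterS qd => y qy yab /=.
have [->|yx] := eqVneq y x; first by rewrite subrr normr0.
move: (qy yx yab); rewrite /q -mulrA mulVf ?subr_eq0// mulr1.
by rewrite [_ + (_ - _)]addrC subrK.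
Qed.
End DeriveOn.

(** * Zero orders and derivatives *)

Section ZeroOrder.
Context {R : realType} {a b : R} {n : nat}.

Lemma zero_order_derive_eq0 (f : R -> R) (x : R) (i : nat) :
  (i < zero_order a b n f x)%N -> derive_onn a b i f x = 0.
Proof.
move=> i_lt; have := before_find 0%N i_lt.
have i_len : (i < n.+1)%N.
  by rewrite (leq_trans i_lt)// -[leqRHS](size_iota 0); exact: find_size.
by rewrite nth_iota// add0n => /negbFE/eqP.
Qed.

(** The bound excludes [n.+1], the value of [find] when all derivatives up to order [n] vanish. *)
Lemma zero_order_derive_neq0 (f : R -> R) (x : R) :
  (zero_order a b n f x <= n)%N ->
  derive_onn a b (zero_order a b n f x) f x != 0.
Proof.
move=> le_n; set i := zero_order _ _ _ _ _ in le_n *.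
have := @nth_find _ 0%N (fun i => derive_onn a b i f x != 0) (iota 0 n.+1).
rewrite has_find -/(zero_order a b n f x) -/i size_iota ltnS => /(_ le_n).
by rewrite nth_iota.
Qed.

Lemma zero_order_gt0 (f : R -> R) (x : R) :
  (0 < zero_order a b n f x)%N = (f x == 0).
Proof. by rewrite /zero_order /=; case: (f x == 0). Qed.

End ZeroOrder.

(** * Independence and positivity of the Bernstein basis *)

Section BernsteinBasis.
Context {R : realType} {a b : R} {n : nat} {U : set (R -> R)}
  {p : 'I_n.+1 -> R -> R}.
Hypotheses (ab : a < b) (chebU : extended_chebyshev a b n U)
  (bernp : bernstein_basis a b U p).

(** The derivatives at [a] form a triangular system: in the [k]-th one, terms with [j > k] vanish by
    their order and terms with [j < k] by induction. *)
Lemma bernstein_basis_free (c : 'I_n.+1 -> R) :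
  {in `[a, b], forall x, \sum_k c k * p k x = 0} -> forall k, c k = 0.
Proof.
move=> cp0 k; have [m] := ubnP (k : nat); elim: m k => // m IH k km.
have aab : a \in `[a, b] by rewrite in_itv/= lexx ltW.
have Cp j : Cn a b n (p j).
  by have [_ CU _] := chebU; apply: CU; have [] := bernp j.
have := derive_onn_eq0 ab n _ c p k Cp cp0 (ltn_ord k) a aab.
rewrite (bigD1 k)//= big1 ?addr0 => [|j jk].
  have [_ _ ordk _] := bernp k.
  move/eqP; rewrite mulf_eq0 => /orP[/eqP //|].
  have := @zero_order_derive_neq0 _ a b n (p k) a.
  by rewrite ordk -ltnS ltn_ord => /(_ isT)/negbTE ->.
have [kj|] := ltnP k j; last rewrite leq_eqVlt => /orP[jk'|jk'].
- have [_ _ ordj _] := bernp j.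
  by rewrite (@zero_order_derive_eq0 _ a b n) ?mulr0// ordj.
- by rewrite -val_eqE jk' in jk.
- by rewrite (IH j) ?mul0r//; exact: leq_trans jk' _.
Qed.

Lemma bernstein_basis_eq0l (k : 'I_n.+1) : k != ord0 -> p k a = 0.
Proof.
move=> k0; have [_ _ orda _] := bernp k.
by apply/eqP; rewrite -(@zero_order_gt0 _ a b n) orda lt0n.
Qed.

Lemma bernstein_basis_eq0r (k : 'I_n.+1) : k != ord_max -> p k b = 0.
Proof.
move=> kn; have [_ _ _ ordb] := bernp k.
apply/eqP; rewrite -(@zero_order_gt0 _ a b n) ordb subn_gt0 ltn_neqAle.
by rewrite -ltnS ltn_ord andbT.
Qed.

(** A zero inside would add to the [k] zeros at [a] and the [n - k] at [b], exceeding [n]. *)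
Lemma bernstein_basis_gt0 (k : 'I_n.+1) : {in `]a, b[, forall x, 0 < p k x}.
Proof.
move=> x; rewrite in_itv/= => /andP[ax xb].
have [Up p_ge0 orda ordb] := bernp k.
rewrite lt_neqAle p_ge0 ?in_itv/= ?ltW// andbT eq_sym; apply/negP => px0.
have [_ _ zeros] := chebU.
(* If [p k] vanished identically, the indicator of [k] would be a nontrivial relation. *)
have pk_neq0 : exists2 y, y \in `[a, b] & p k y != 0.
  apply: contrapT => pk0.
  have : (1 : R) = 0.
    have := bernstein_basis_free (fun j => (j == k)%:R) _ k.
    rewrite eqxx; apply => y yab.
    rewrite (bigD1 k)//= eqxx mul1r big1 => [|j /negbTE ->]; last by rewrite mul0r.
    rewrite addr0; apply: contrapT => /eqP pky; apply: pk0; by exists y.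
  by move/eqP; rewrite oner_eq0.
have := zeros _ Up pk_neq0 [:: a; b; x].
rewrite /= !inE !negb_or (lt_eqF ab) (lt_eqF ax) (gt_eqF xb)/= => /(_ isT).
have sub : {subset [:: a; b; x] <= `[a, b]}.
  move=> y; rewrite in_itv/= !inE.
  by move=> /or3P[] /eqP ->; rewrite ?lexx !ltW.
move=> /(_ sub); rewrite !big_cons big_nil orda ordb addn0 addnA subnKC; last first.
  by rewrite -ltnS.
by rewrite -[leqRHS]addn0 leq_add2l leqNgt zero_order_gt0 px0.
Qed.

End BernsteinBasis.

(** * Support functions of generalized convex functions *)

Section Support.
Context {R : realType} {a b : R} {f0 f1 : R -> R}.
Hypotheses (f0_gt0 : {in `[a, b], forall x, 0 < f0 x})
  (f1f0 : {in `[a, b] &, {homo (fun x => f1 x / f0 x) : x y / x < y}}).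

(** After division by [f0] and with [f1 / f0] as variable, this is the three-chord inequality of
    ordinary convexity. *)
Lemma convex2_slope (phi : R -> R) (y x z : R) :
  convex2 a b f0 f1 phi -> y \in `[a, b] -> z \in `[a, b] -> y < x -> x < z ->
  (phi y / f0 y - phi x / f0 x) / (f1 y / f0 y - f1 x / f0 x) <=
  (phi z / f0 z - phi x / f0 x) / (f1 z / f0 z - f1 x / f0 x).
Proof.
move=> cvx yab zab yx xz.
have xab : x \in `[a, b].
  move: yab zab; rewrite !in_itv/= => /andP[ay _] /andP[_ zb].
  by rewrite (le_trans ay (ltW yx)) (le_trans (ltW xz) zb).
have := f0_gt0 _ yab; have := f0_gt0 _ xab; have := f0_gt0 _ zab.
move=> fz fx fy.
have gyx := f1f0 _ _ yab xab yx; have gxz := f1f0 _ _ xab zab xz.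
have divE (h : R -> R) u : 0 < f0 u -> h u = f0 u * (h u / f0 u).
  by move=> fu; rewrite mulrC divfK// gt_eqF.
have := (divE f1 z fz, divE f1 x fx, divE f1 y fy).
have := (divE phi z fz, divE phi x fx, divE phi y fy).
rewrite /= in gyx gxz.
set Y := phi y / f0 y; set X := phi x / f0 x; set Z := phi z / f0 z.
set gy := f1 y / f0 y in gyx *; set gx := f1 x / f0 x in gyx gxz *.
set gz := f1 z / f0 z in gxz *.
move=> [[phiz phix] phiy] [[f1z f1x] f1y].
(* [c1] is the slope of the chord from [y] to [z]; the interpolant is
   [(Y - c1 * gy) * f0 + c1 * f1]. *)
have [c1 c1E] : exists c1, c1 * (gz - gy) = Z - Y.
  by exists ((Z - Y) / (gz - gy)); rewrite divfK// subr_eq0 gt_eqF//; lra.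
have {cvx} : phi x <= (Y - c1 * gy) * f0 x + c1 * f1 x.
  apply: (cvx y z) => //; first exact: lt_trans xz.
  - by rewrite phiy f1y; ring.
  - rewrite phiz f1z; have -> : Z = Y + c1 * (gz - gy) by rewrite c1E; ring.
    ring.
  - by rewrite in_itv/= !ltW.
rewrite phix f1x.
have -> : (Y - c1 * gy) * f0 x + c1 * (f0 x * gx) =
  f0 x * (Y + c1 * (gx - gy)) by ring.
rewrite ler_pM2l// => Xle.
rewrite ler_pdivlMr ?subr_gt0// mulrAC ler_ndivrMr ?subr_lt0//.
nra.
Qed.

(** The supremum of the slopes to the left of [x] is also at most every slope to the right. As [x]
    is interior, [s a] makes the set nonempty and [s b] bounds it. *)
Lemma convex2_support (phi : R -> R) : convex2 a b f0 f1 phi ->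
  {in `]a, b[, forall x, exists c0 c1 : R,
    c0 * f0 x + c1 * f1 x = phi x /\
    {in `[a, b], forall y, c0 * f0 y + c1 * f1 y <= phi y}}.
Proof.
move=> cvx x; rewrite in_itv/= => /andP[ax xb].
have xab : x \in `[a, b] by rewrite in_itv/= !ltW.
have aab : a \in `[a, b] by rewrite in_itv/= lexx ltW// (lt_trans ax).
have bab : b \in `[a, b] by rewrite in_itv/= lexx ltW// (lt_trans ax).
pose s y := (phi y / f0 y - phi x / f0 x) / (f1 y / f0 y - f1 x / f0 x).
pose S := s @` `[a, x[.
have ub z : z \in `[a, b] -> x < z -> ubound S (s z).
  move=> zab xz _ [y /= + <-]; rewrite in_itv/= => /andP[ay yx].
  apply: convex2_slope => //.
  by rewrite in_itv/= ay ltW// (lt_trans yx).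
pose c1 := sup S.
exists (phi x / f0 x - c1 * (f1 x / f0 x)), c1; split.
  by field; rewrite gt_eqF// f0_gt0.
move=> y yab.
have fy := f0_gt0 _ yab.
have -> : (phi x / f0 x - c1 * (f1 x / f0 x)) * f0 y + c1 * f1 y =
  (phi x / f0 x + c1 * (f1 y / f0 y - f1 x / f0 x)) * f0 y.
  by field; rewrite !gt_eqF// f0_gt0.
rewrite -ler_pdivlMr// -lerBrDl.
have [yx|xy|->] := ltgtP y x; last by rewrite !subrr mulr0.
- rewrite -ler_ndivrMr ?subr_lt0 ?f1f0//.
  apply: ub_le_sup; first by exists (s b); exact: ub.
  exists y => //=; rewrite in_itv/= yx andbT.
  by move: yab; rewrite in_itv/= => /andP[].
- rewrite -ler_pdivlMr ?subr_gt0 ?f1f0//.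
  apply: ge_sup; last exact: ub.
  by exists (s a), a => //=; rewrite in_itv/= lexx.
Qed.

Lemma strict_convex2W (phi : R -> R) :
  strict_convex2 a b f0 f1 phi -> convex2 a b f0 f1 phi.
Proof.
move=> cvx x y xab yab xy c0 c1 hx hy z; rewrite in_itv/= => /andP[].
rewrite le_eqVlt => /orP[/eqP <-|xz]; first by rewrite hx.
rewrite le_eqVlt => /orP[/eqP ->|zy]; first by rewrite hy.
by apply/ltW/(cvx x y) => //; rewrite in_itv/= xz.
Qed.

(* If a support function met [phi] at a second point, it would interpolate
   [phi] there, and strict convexity would put it above [phi] in between. *)
Lemma strict_convex2_support (phi : R -> R) : strict_convex2 a b f0 f1 phi ->
  {in `]a, b[, forall x, exists c0 c1 : R,
    c0 * f0 x + c1 * f1 x = phi x /\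
    {in `[a, b], forall y, y != x -> c0 * f0 y + c1 * f1 y < phi y}}.
Proof.
move=> cvx x xab.
have [c0 [c1 [hx h_le]]] := convex2_support _ (strict_convex2W _ cvx) _ xab.
have {}xab : x \in `[a, b].
  by move: xab; rewrite !in_itv/= => /andP[ax xb]; rewrite !ltW.
exists c0, c1; split=> // y yab yx; rewrite lt_neqAle h_le// andbT.
apply/negP => /eqP hy.
have meet u v : u \in `[a, b] -> v \in `[a, b] -> u < v ->
    c0 * f0 u + c1 * f1 u = phi u -> c0 * f0 v + c1 * f1 v = phi v -> False.
  move=> uab vab uv hu hv.
  have /= midlt := midf_lt uv.
  have mid : (u + v) / 2 \in `]u, v[ by rewrite in_itv/= !midf_lt.
  have := cvx _ _ uab vab uv _ _ hu hv _ mid.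
  rewrite ltNge h_le//; move: uab vab mid; rewrite !in_itv/=.
  move=> /andP[au _] /andP[_ vb] /andP[um mv].
  by rewrite (le_trans au (ltW um)) (le_trans (ltW mv) vb).
by move: yx; rewrite neq_lt => /orP[xy|xy]; [exact: (meet y x)|exact: (meet x y)].
Qed.

End Support.

(** * Jensen inequalities for a single measure *)

Section Jensen.
Context {R : realType} {a b : R} {f0 f1 : R -> R}
  {mu : {measure set (measurableTypeR R) -> \bar R}}.
Hypothesis mu_fin : (mu `[a, b]%classic < +oo)%E.
Local Notation I f := (\int[mu]_(y in `[a, b]) f y).

Lemma within_continuous_integrable (f : R -> R) :
  {within `[a, b], continuous f} -> mu.-integrable `[a, b] (EFin \o f).
Proof.
move=> cf; apply: measurable_bounded_integrable => //.
- exact: measurable_realfun.subspace_continuous_measurable_fun.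
- have [M [Mreal hM]] :=
    compact_bounded (continuous_compact cf (@segment_compact _ a b)).
  by exists M; split => // y /hM h z zab; apply: h; exists z.
Qed.

Lemma within_continuous_lincomb (f g : R -> R) (u v : R) :
  {within `[a, b], continuous f} -> {within `[a, b], continuous g} ->
  {within `[a, b], continuous (fun y => u * f y + v * g y)}.
Proof.
move=> cf cg x; apply: cvgD; apply: cvgMl_tmp; [exact: cf|exact: cg].
Qed.

Lemma Rintegral_lincomb (f g : R -> R) (u v : R) :
  {within `[a, b], continuous f} -> {within `[a, b], continuous g} ->
  I (fun y => u * f y + v * g y) = u * I f + v * I g.
Proof.
move=> cf cg.
have int_cst (h : R -> R) (w : R) : {within `[a, b], continuous h} ->
    mu.-integrable `[a, b] (EFin \o (fun y => w * h y)).
  move=> ch; apply: within_continuous_integrable => x.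
  by apply: cvgMl_tmp; exact: ch.
rewrite RintegralD//; [|exact: int_cst..].
by rewrite !RintegralZl//; exact: within_continuous_integrable.
Qed.

(** As [g] vanishes almost everywhere, [mu] lives at [c]. The cross-multiplied form avoids naming
    the mass at [c]; it is later used with [h = f0], whose integral is 1. *)
Lemma Rintegral_concentrated (g f h : R -> R) (c : R) :
  {within `[a, b], continuous g} -> {within `[a, b], continuous f} ->
  {within `[a, b], continuous h} ->
  {in `[a, b], forall y, 0 <= g y} ->
  {in `[a, b], forall y, y != c -> 0 < g y} ->
  I g = 0 -> h c * I f = f c * I h.
Proof.
move=> cg cf ch g_ge0 g_gt0 Ig0.
have mD : measurable (`[a, b]%classic : set (measurableTypeR R)) by [].
(* Integrability matters here: [fine] also sends infinite values to 0. *)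
have Ig : (\int[mu]_(y in `[a, b]) (g y)%:E = 0)%E.
  rewrite -[LHS]fineK; first by congr EFin.
  by apply: integrable_fin_num => //; exact: within_continuous_integrable.
have g0 : ae_eq mu `[a, b]%classic (EFin \o g) (cst 0%E).
  apply/(ae_eq_integral_abs _ mD); first by apply: (measurable_int mu); exact: within_continuous_integrable.
  rewrite -[RHS]Ig; apply: eq_integral => y.
  by rewrite inE => yab; rewrite /= ger0_norm// g_ge0.
have := Rintegral_lincomb f h (h c) (- f c) cf ch.
(* This combination vanishes at [c], and the points off [c] are negligible because [g] is positive
   there. *)
suff -> : I (fun y => h c * f y + - f c * h y) = 0 by lra.
rewrite /Rintegral.
have -> : (\int[mu]_(y in `[a, b]) (h c * f y + - f c * h y)%:E)%E =
    (\int[mu]_(y in `[a, b]) 0)%E.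
  apply: ae_eq_integral => //.
    apply: (measurable_int mu); apply: within_continuous_integrable.
    exact: within_continuous_lincomb.
  apply: filterS g0 => y gy yab.
  have [->|yc] := eqVneq y c; first by congr EFin; ring.
  by have := g_gt0 y yab yc; move: (gy yab) => /= [->]; rewrite ltxx.
by rewrite integral0.
Qed.

Hypotheses (f0_gt0 : {in `[a, b], forall x, 0 < f0 x})
  (f1f0 : {in `[a, b] &, {homo (fun x => f1 x / f0 x) : x y / x < y}})
  (cf0 : {within `[a, b], continuous f0})
  (cf1 : {within `[a, b], continuous f1}).
Context {c : R}.
(** Here [c] stands for a node [t k] and [mu] for [mu k]. *)
Hypotheses (cab : c \in `[a, b]) (I0 : I f0 = 1) (I1 : f0 c * I f1 = f1 c).

(** By [I0] and [I1] the support function integrates to its value at [c], so the integrated gap is,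
    up to [f0 c], the defect in Jensen's inequality. *)
Lemma Rintegral_support (phi : R -> R) (c0 c1 : R) :
  {within `[a, b], continuous phi} -> c0 * f0 c + c1 * f1 c = phi c ->
  f0 c * I (fun y => phi y - (c0 * f0 y + c1 * f1 y)) = f0 c * I phi - phi c.
Proof.
move=> cphi hc; under eq_Rintegral do rewrite -mulN1r -[phi _]mul1r.
rewrite Rintegral_lincomb//; last exact: within_continuous_lincomb.
by rewrite Rintegral_lincomb// I0 -hc -I1; ring.
Qed.

(* At an endpoint, [f1 / f0] takes its extremal value, so a measure for which
   it has that mean is concentrated there. *)
Lemma Rintegral_endpoint (f : R -> R) : c = a \/ c = b ->
  {within `[a, b], continuous f} -> f0 c * I f = f c.
Proof.
move=> cE cf; rewrite -[RHS]mulr1 -I0.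
have fc := f0_gt0 _ cab.
(* The sign is 1 where [f1 / f0] is minimal and -1 where it is maximal, so that [g] is positive off
   [c] in both cases. *)
pose e : R := if c == a then 1 else -1.
pose g y := e * (f0 c) * f1 y + - e * f1 c * f0 y.
have cg : {within `[a, b], continuous g} by exact: within_continuous_lincomb.
have Ig : I g = 0 by rewrite Rintegral_lincomb// I0 -I1; ring.
have g_gt0 : {in `[a, b], forall y, y != c -> 0 < g y}.
  move=> y yab yc; have fy := f0_gt0 _ yab.
  have -> : g y = f0 c * f0 y * (e * (f1 y / f0 y - f1 c / f0 c)).
    by rewrite /g; field; rewrite !gt_eqF.
  rewrite pmulr_rgt0 /e; last exact: mulr_gt0.
  move: yab; rewrite in_itv/= => /andP[ay yb].
  case: eqP => /= [ca|/eqP ca].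
    rewrite mul1r subr_gt0; apply: f1f0 => //; first by rewrite in_itv/= ay.
    by rewrite lt_neqAle eq_sym yc ca.
  have cb : c = b by case: cE => // /eqP; rewrite (negbTE ca).
  rewrite mulN1r oppr_gt0 subr_lt0; apply: f1f0 => //; first by rewrite in_itv/= ay.
  by rewrite lt_neqAle yc cb.
apply: (Rintegral_concentrated g) => // y yab.
have [->|yc] := eqVneq y c; last exact/ltW/g_gt0.
by rewrite /g (_ : _ + _ = 0)//; ring.
Qed.

(** Support functions are available only at interior points, so endpoints are treated apart. *)
Lemma endpointVinterior : (c = a \/ c = b) \/ c \in `]a, b[.
Proof.
move: cab; rewrite !in_itv/= => /andP[].
rewrite le_eqVlt => /orP[/eqP ->|ac]; first by left; left.
rewrite le_eqVlt => /orP[/eqP ->|cb]; first by left; right.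
by right; rewrite ac.
Qed.

Lemma convex2_Jensen (phi : R -> R) : {within `[a, b], continuous phi} ->
  convex2 a b f0 f1 phi -> phi c <= f0 c * I phi.
Proof.
move=> cphi cvx.
have [cE|cI] := endpointVinterior; first by rewrite Rintegral_endpoint.
have [c0 [c1 [hc h_le]]] := convex2_support f0_gt0 f1f0 _ cvx _ cI.
rewrite -subr_ge0 -(Rintegral_support _ _ _ cphi hc).
apply: mulr_ge0; first exact/ltW/f0_gt0.
by apply: Rintegral_ge0 => y yab; rewrite subr_ge0 h_le.
Qed.

(** At an interior [c], equality makes the integral of the gap between [psi] and its support
    function vanish; that gap is positive off [c]. *)
Lemma strict_convex2_Jensen_eq (psi f : R -> R) :
  {within `[a, b], continuous psi} -> strict_convex2 a b f0 f1 psi ->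
  psi c = f0 c * I psi -> {within `[a, b], continuous f} ->
  f c = f0 c * I f.
Proof.
move=> cpsi cvx psic cf.
have [cE|cI] := endpointVinterior; first by rewrite Rintegral_endpoint.
have [c0 [c1 [hc h_lt]]] := strict_convex2_support f0_gt0 f1f0 _ cvx _ cI.
rewrite -[LHS]mulr1 -I0; symmetry.
have g_gt0 : {in `[a, b], forall y, y != c ->
    0 < psi y - (c0 * f0 y + c1 * f1 y)}.
  by move=> y yab yc; rewrite subr_gt0 h_lt.
apply: Rintegral_concentrated g_gt0 _ => //.
- move=> x; apply: cvgB; first exact: cpsi.
  exact: within_continuous_lincomb.
- move=> y yab; have [->|yc] := eqVneq y c; first by rewrite hc subrr.
  by rewrite subr_ge0 ltW// h_lt.
- have /eqP := Rintegral_support _ _ _ cpsi hc.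
  by rewrite -psic subrr mulf_eq0 (gt_eqF (f0_gt0 _ cab)) => /eqP.
Qed.

End Jensen.

(** * Comparison of the two operators and the equality case *)

Theorem theorem6 (R : realType) (a b : R) (n : nat) (U : set (R -> R))
    (f0 f1 : R -> R) (t : 'I_n.+1 -> R) (p : 'I_n.+1 -> R -> R)
    (mu : 'I_n.+1 -> {measure set (measurableTypeR R) -> \bar R}) :
  a < b ->
  (1 <= n)%N ->
  extended_chebyshev a b n U ->
  U f0 ->
  U f1 ->
  {in `[a, b], forall x, 0 < f0 x} ->
  {in `[a, b] &, {homo (fun x => f1 x / f0 x) : x y / x < y}} ->
  bernstein_basis a b U p ->
  (forall k, t k \in `[a, b]) ->
  t ord0 = a ->
  t ord_max = b ->
  {in `[a, b], bernstein_op t p f0 =1 f0} ->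
  {in `[a, b], bernstein_op t p f1 =1 f1} ->
  (forall k, (mu k `[a, b]%classic < +oo)%E) ->
  {in `[a, b], integral_op a b f0 t p mu f0 =1 f0} ->
  {in `[a, b], integral_op a b f0 t p mu f1 =1 f1} ->
  (forall phi : R -> R, {within `[a, b], continuous phi} ->
     convex2 a b f0 f1 phi ->
     {in `[a, b], forall x,
       phi x <= bernstein_op t p phi x <= integral_op a b f0 t p mu phi x}) /\
  ((exists2 x : R, x \in `]a, b[ &
      exists psi : R -> R,
        [/\ {within `[a, b], continuous psi},
            strict_convex2 a b f0 f1 psi &
            bernstein_op t p psi x = integral_op a b f0 t p mu psi x]) ->
   forall f : R -> R, {within `[a, b], continuous f} ->
     {in `[a, b], bernstein_op t p f =1 integral_op a b f0 t p mu f}).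
Proof.
move=> ab n_gt0 chebU Uf0 Uf1 f0_gt0 f1f0 bernp tab ta tb Bf0 Bf1 mu_fin Lf0 Lf1.
have [_ CU _] := chebU.
(* Since [n] is positive, functions in [U] are derivable, hence continuous. *)
have cU f : U f -> {within `[a, b], continuous f}.
  by move=> /CU[/(_ 0%N n_gt0) df _]; exact: derivable_on_continuous.
have [cf0 cf1] := (cU _ Uf0, cU _ Uf1).
have free := bernstein_basis_free ab chebU bernp.
have coefE f : {in `[a, b], bernstein_op t p f =1 f} ->
    {in `[a, b], integral_op a b f0 t p mu f =1 f} ->
    forall k, f0 (t k) * \int[mu k]_(y in `[a, b]) f y = f (t k).
  move=> Bf Lf k; apply/eqP; rewrite -subr_eq0; apply/eqP.
  apply: (free (fun k => f0 (t k) * \int[mu k]_(y in `[a, b]) f y - f (t k))).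
  move=> x xab; under eq_bigr do rewrite mulrBl.
  rewrite sumrB; apply/eqP; rewrite subr_eq0; apply/eqP.
  exact: etrans (Lf x xab) (esym (Bf x xab)).
have I1 := coefE _ Bf1 Lf1.
have I0 k : \int[mu k]_(y in `[a, b]) f0 y = 1.
  have ft := f0_gt0 _ (tab k); apply: (mulfI (lt0r_neq0 ft)).
  by rewrite mulr1 coefE.
have p_ge0 k : {in `[a, b], forall x, 0 <= p k x} by have [] := bernp k.
split=> [phi cphi cvx x xab|[x xab [psi [cpsi cvx BLpsi]]] f cf y yab].
- apply/andP; split; last first.
    apply: ler_sum => k _; apply: ler_wpM2r; first exact: p_ge0.
    exact: (convex2_Jensen (mu_fin k) f0_gt0 f1f0 cf0 cf1 (tab k)
      (I0 k) (I1 k)).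
  (* At an endpoint only one basis function survives, and fixing [f0] forces its value to be 1, so
     [B] interpolates [phi] there. *)
  have [[xE|xE]|xI] := endpointVinterior xab.
  + have B0 h : bernstein_op t p h a = h a * p ord0 a.
      rewrite /bernstein_op (bigD1 ord0)//= big1 ?addr0 ?ta// => k k0.
      by rewrite (bernstein_basis_eq0l bernp)// mulr0.
    have aab : a \in `[a, b] by rewrite in_itv/= lexx ltW.
    have p1 : p ord0 a = 1.
      have := Bf0 a aab; rewrite B0 -[RHS]mulr1.
      by apply: mulfI; rewrite gt_eqF// f0_gt0.
    by rewrite xE B0 p1 mulr1.
  + have B0 h : bernstein_op t p h b = h b * p ord_max b.
      rewrite /bernstein_op (bigD1 ord_max)//= big1 ?addr0 ?tb// => k kn.
      by rewrite (bernstein_basis_eq0r bernp)// mulr0.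
    have bab : b \in `[a, b] by rewrite in_itv/= lexx ltW.
    have p1 : p ord_max b = 1.
      have := Bf0 b bab; rewrite B0 -[RHS]mulr1.
      by apply: mulfI; rewrite gt_eqF// f0_gt0.
    by rewrite xE B0 p1 mulr1.
  (* The support function equals its image under [B], which is compared with that of [phi] node by
     node. *)
  + have [c0 [c1 [<- h_le]]] := convex2_support f0_gt0 f1f0 _ cvx _ xI.
    rewrite -[f0 x]Bf0// -[f1 x]Bf1// !mulr_sumr -big_split/=.
    apply: ler_sum => k _; rewrite !mulrA -mulrDl.
    by apply: ler_wpM2r; [exact: p_ge0|exact: h_le].
(* The termwise differences are nonnegative with sum 0, so each vanishes, and [p k x > 0] can be
   cancelled. *)
- have psiE k : psi (t k) = f0 (t k) * \int[mu k]_(y in `[a, b]) psi y.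
    have xab' : x \in `[a, b].
      by move: xab; rewrite !in_itv/= => /andP[ax xb]; rewrite !ltW.
    have le j : psi (t j) * p j x <=
        f0 (t j) * \int[mu j]_(y in `[a, b]) psi y * p j x.
      apply: ler_wpM2r; first exact: p_ge0.
      apply: (convex2_Jensen (mu_fin j) f0_gt0 f1f0 cf0 cf1 (tab j)
        (I0 j) (I1 j)) => //.
      exact: strict_convex2W.
    have /eqP := BLpsi; rewrite /bernstein_op /integral_op.
    rewrite -subr_eq0 -oppr_eq0 opprB -sumrB psumr_eq0 => [/allP/(_ k)|j _];
      last by rewrite subr_ge0.
    rewrite mem_index_enum => /(_ isT)/=; rewrite -mulrBl mulf_eq0.
    rewrite (gt_eqF (bernstein_basis_gt0 ab chebU bernp k _ xab)) orbF.
    by rewrite subr_eq0 => /eqP.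
  apply: eq_bigr => k _; congr (_ * _).
  exact: (strict_convex2_Jensen_eq (mu_fin k) f0_gt0 f1f0 cf0 cf1 (tab k)
    (I0 k) (I1 k) _ _ cpsi cvx (psiE k) cf).
Qed.
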